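(* Let $\{Y(t)\}_{t\ge0}$ be a Lévy process, and let $\{S_{\alpha,\theta}(t)\}_{t\ge0}$ be the tempered incomplete gamma (TInG) subordinator with parameters $\alpha$ and $\theta>0$, independent of $\{Y(t)\}_{t\ge0}$. Then the Lévy process subordinated with the TInG subordinator (LTInG), that is, the process $\{Q_{\alpha,\theta}(t)\}_{t\ge0}$ defined by $Q_{\alpha,\theta}(t):=Y(S_{\alpha,\theta}(t))$, $t\ge0$, has the long-range dependence (LRD) property.
   Context: The lower incomplete gamma function is $\gamma(\alpha;\eta)=\int_0^\eta e^{-y}y^{\alpha-1}\,dy$, for $\eta>0$, $0<\alpha\le1$. The tempered incomplete gamma (TInG) subordinator $\{S_{\alpha,\theta}(t)\}_{t\ge0}$, with $0<\alpha\le1$ and tempering parameter $\theta>0$, is the non-decreasing Lévy process with Laplace exponent $\alpha\gamma(\alpha;\eta+\theta)-\alpha\gamma(\alpha;\theta)$, i.e. $\mathbb{E}[e^{-\eta S_{\alpha,\theta}(t)}]=\exp\left(-t\alpha\left(\gamma(\alpha;\eta+\theta)-\gamma(\alpha;\theta)\right)\right)$, $\eta>0$. Long-range dependence: let $0<s<t$ with $s$ fixed. Assume that a stochastic process $\{X(t)\}_{t\ge0}$ has a correlation function $\mathrm{Corr}[X(s),X(t)]$ satisfying $$c_1(s)t^{-d}\le \mathrm{Corr}[X(s),X(t)]\le c_2(s)t^{-d}$$ for large $t$, with $d>0$, $c_1(s)>0$ and $c_2(s)>0$; that is, $$\lim_{t\to\infty}\frac{\mathrm{Corr}[X(s),X(t)]}{t^{-d}}=c(s)$$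 for some $c(s)>0$ and $d>0$. The process $\{X(t)\}_{t\ge0}$ has the long-range dependence (LRD) property if $d\in(0,1)$, and the short-range dependence (SRD) property if $d\in(1,2)$.
   Formalization: The Lévy process Y is also assumed to have finite second moments and not to be almost surely identically zero; otherwise the correlation of Q is undefined (e.g. Y Cauchy, or Y = 0). *)

(* Defs.v *)
From HB Require Import structures.
From mathcomp Require Import all_boot all_order all_algebra.
From mathcomp Require Import all_classical all_reals all_analysis.
Set Implicit Arguments.
Unset Strict Implicit.
Unset Printing Implicit Defensive.
Import Order.TTheory GRing.Theory Num.Theory.
Import numFieldNormedType.Exports.
Local Open Scope classical_set_scope.
Local Open Scope ring_scope.

(* A real-valued process {X(t)}, t >= 0, on the probability space (T, P) is
   represented by a function X : R -> T -> R; every definition below constrains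
   X at times t >= 0 only, the values at negative times are junk. *)

Section processes.
Context (d : measure_display) (T : measurableType d) (R : realType)
  (P : probability T R).
Implicit Types X Y S : R -> T -> R.

(* Mutual independence of the increments over consecutive intervals
   [t_0, t_1], ..., [t_(n-1), t_n]; the product rule for subfamilies is the case
   B i = setT for the discarded indices. *)
Definition independent_increments X : Prop :=
  forall (n : nat) (t : nat -> R) (B : nat -> set R),
    0 <= t 0%N -> (forall i, t i <= t i.+1) -> (forall i, measurable (B i)) ->
    let A i := [set w | B i (X (t i.+1) w - X (t i) w)] in
    P (\bigcap_(i < n) A i) = (\prod_(i < n) P (A i))%E.

Definition stationary_increments X : Prop :=
  forall (s h : R) (B : set R), 0 <= s -> 0 <= h -> measurable B ->
    P [set w | B (X (s + h) w - X s w)] = P [set w | B (X h w - X 0 w)].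

Definition continuous_in_probability X : Prop :=
  forall s e : R, 0 <= s -> 0 < e ->
    P [set w | e <= `|X u w - X s w| ]
      @[u --> within [set u | 0 <= u] (nbhs s)] --> 0%E.

Definition cadlag_paths X : Prop :=
  forall w : T,
    (forall t : R, 0 <= t -> X u w @[u --> t^'+] --> X t w) /\
    (forall t : R, 0 < t -> cvg (X u w @[u --> t^'-])).

(* Path regularity is required of every path, and not only of almost every one,
   so that X (S t w) w is measurable in w although P need not be complete. *)
Record levy_process X : Prop := LevyProcess {
  levy_measurable : forall t, 0 <= t -> measurable_fun setT (X t) ;
  levy_start0 : {ae P, forall w, X 0 w = 0} ;
  levy_independent : independent_increments X ;
  levy_stationary : stationary_increments X ;
  levy_continuous : continuous_in_probability X ;
  levy_cadlag : cadlag_paths X }.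

Record subordinator S : Prop := Subordinator {
  subordinator_levy : levy_process S ;
  subordinator_ge0 : forall t w, 0 <= t -> 0 <= S t w ;
  subordinator_homo : forall s t w, 0 <= s -> s <= t -> S s w <= S t w }.

Definition lower_gamma (alpha eta : R) : R :=
  \int[lebesgue_measure]_(y in `]0, eta[%classic)
    (expR (- y) * y `^ (alpha - 1)).

Definition ting_subordinator (alpha theta : R) S : Prop :=
  subordinator S /\
  forall t eta : R, 0 <= t -> 0 < eta ->
    ('E_P[fun w => (expR (- eta * S t w))%R])%E =
    (expR (- t * (alpha * lower_gamma alpha (eta + theta)
                  - alpha * lower_gamma alpha theta)))%:E.

Definition sigma_process X : set (set T) :=
  <<s [set A | exists t B, [/\ 0 <= t, measurable B & A = X t @^-1` B]] >>.

Definition independent_processes X Y : Prop :=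
  forall A B : set T, sigma_process X A -> sigma_process Y B ->
    P (A `&` B) = (P A * P B)%E.

Definition time_change Y S : R -> T -> R := fun t w => Y (S t w) w.

Definition square_integrable X : Prop :=
  forall t, 0 <= t -> X t \in Lfun P 2%:E.

Definition nonzero_process X : Prop :=
  exists2 t, 0 <= t & ~ {ae P, forall w, X t w = 0}.

Definition corr (U V : T -> R) : R :=
  fine (covariance P U V) / (Num.sqrt (fine ('V_P[U])%E) * Num.sqrt (fine ('V_P[V])%E)).

(* [corr] is total with junk values; this says that Corr[X(s), X(t)] is
   mathematically defined for all s, t > 0. *)
Definition has_correlation X : Prop :=
  square_integrable X /\ (forall t, 0 < t -> (0 < 'V_P[X t])%E).

(* The exponent delta does not depend on s, the constant c does. *)
Definition correlation_decay (delta : R) X : Prop :=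
  forall s, 0 < s -> exists2 c : R, 0 < c &
    corr (X s) (X t) / t `^ (- delta) @[t --> +oo] --> c.

Definition long_range_dependent X : Prop :=
  has_correlation X /\
  exists delta : R, 0 < delta < 1 /\ correlation_decay delta X.

End processes.

(* Main.v *)
Require Import Defs.
From HB Require Import structures.
From mathcomp Require Import all_boot all_order all_algebra.
From mathcomp Require Import all_classical all_reals all_analysis.
From mathcomp Require Import measurable_realfun.
From mathcomp Require Import ring lra.
Set Implicit Arguments.
Unset Strict Implicit.
Unset Printing Implicit Defensive.
Import Order.TTheory GRing.Theory Num.Theory.
Import numFieldNormedType.Exports.
Local Open Scope classical_set_scope.
Local Open Scope ring_scope.

(* The correlation is computed exactly: Corr[Q(s), Q(t)] = sqrt (s / t) for
   0 < s <= t, so that d = 1/2 and c(s) = sqrt s.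

   A square-integrable Levy process X satisfies E X(t) = m t and
   E X(s)X(t) = v min(s, t) + m^2 s t; this applies to Y and also to S, with
   constants mu and sg in place of m and v.  As Y is independent of S, Fubini's
   theorem allows one to integrate over Y with S(s) and S(t) fixed, which gives
   Cov(Q(s), Q(t)) = K min(s, t) with K = v mu + m^2 sg.

   Let phi be the Laplace exponent of S.  Its increments are integrals of the
   decreasing function exp(-y) y^(alpha - 1) over intervals away from 0.  Hence
   the second differences of eta |-> E exp(-eta S(t)) at 0 are O(eta^2), which
   bounds E S(t)^2, and phi is not linear, so that S(1) is not almost surely
   constant; therefore mu > 0, sg > 0 and K > 0. *)

(** * Independence *)

(** Positive and negative parts are transported separately, so no integrability is required: both
    sides are the same difference in the extended reals. *)
Lemma integral_distribution_measurable {d d'} {T : measurableType d}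
    {T' : measurableType d'} {R : realType} (P : probability T R)
    (X : {mfun T >-> T'}) (f : T' -> \bar R) : measurable_fun setT f ->
  (\int[distribution P X]_y f y = \int[P]_w f (X w))%E.
Proof.
move=> mf; rewrite integralE [RHS]integralE.
rewrite !ge0_integral_distribution//; last 2 first.
- exact: measurable_funeneg.
- exact: measurable_funepos.
by rewrite -(funepos_comp f X) -(funeneg_comp f X).
Qed.

Section independence.
Context {d} {T : measurableType d} {R : realType} (P : probability T R).

(** The target spaces are arbitrary because one of the maps will take values in a space that encodes
    whole paths. *)
Definition independent_maps {d1 d2} {T1 : measurableType d1}
    {T2 : measurableType d2} (U : T -> T1) (W : T -> T2) : Prop :=
  forall A B, measurable A -> measurable B ->
    P (U @^-1` A `&` W @^-1` B) = (P (U @^-1` A) * P (W @^-1` B))%E.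

Context {d1 d2} {T1 : measurableType d1} {T2 : measurableType d2}.
Variables (U : {mfun T >-> T1}) (W : {mfun T >-> T2}).
Hypothesis UW : independent_maps U W.

Let pairUW : T -> T1 * T2 := fun w => (U w, W w).
Let mpairUW : measurable_fun setT pairUW.
Proof. exact/measurable_fun_pair. Qed.
HB.instance Definition _ := isMeasurableFun.Build _ _ _ _ pairUW mpairUW.

(** A product measure is determined by its values on rectangles, and there the claim is exactly
    independence. *)
Let dpair : forall X, measurable X ->
  (distribution P U \x distribution P W)%E X = pushforward P pairUW X.
Proof. by apply: product_measure_unique => A B mA mB; exact: UW. Qed.

Local Open Scope ereal_scope.

(** The joint law of the pair is the product of the two laws; after Tonelli each law is pulled back
    to [P]. The variable [w'] thus acts as an independent copy of [w]. *)
Lemma independent_tonelli (F : T1 * T2 -> \bar R) :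
  measurable_fun setT F -> (forall x, 0 <= F x) ->
  \int[P]_w F (U w, W w) = \int[P]_w \int[P]_w' F (U w, W w').
Proof.
move=> mF F0.
transitivity (\int[pushforward P pairUW]_x F x).
  by rewrite ge0_integral_distribution.
transitivity (\int[distribution P U \x distribution P W]_x F x).
  by apply: eq_measure_integral => X mX _; exact/esym/dpair.
rewrite fubini_tonelli1// ge0_integral_distribution//=; last first.
- by move=> x; apply: integral_ge0.
- exact: measurable_fun_fubini_tonelli_F.
apply: eq_integral => w _; rewrite /= /fubini_F ge0_integral_distribution//.
exact: measurableT_comp mF (measurable_pair1 _).
Qed.

Lemma independent_fubini (F : T1 * T2 -> \bar R) :
  measurable_fun setT F -> P.-integrable setT (fun w => F (U w, W w)) ->
  \int[P]_w F (U w, W w) = \int[P]_w \int[P]_w' F (U w, W w').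
Proof.
move=> mF iF.
have iF' : (distribution P U \x distribution P W).-integrable setT F.
  apply/integrableP; split => //.
  rewrite (eq_measure_integral (pushforward P pairUW)); last first.
    by move=> X mX _; exact/dpair.
  rewrite ge0_integral_distribution//=; last exact: measurableT_comp.
  by case/integrableP : iF.
transitivity (\int[pushforward P pairUW]_x F x).
  by rewrite integral_distribution.
transitivity (\int[distribution P U \x distribution P W]_x F x).
  by apply: eq_measure_integral => X mX _; exact/esym/dpair.
rewrite -integral12_prod_meas1// integral_distribution_measurable//=; last first.
  exact: measurable_fubini_F iF'.
apply: eq_integral => w _; rewrite /fubini_F integral_distribution_measurable//.
exact: measurableT_comp mF (measurable_pair1 _).
Qed.

End independence.

Section independent_product.
Context {d} {T : measurableType d} {R : realType} (P : probability T R).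
Local Open Scope ereal_scope.

Lemma independent_expectation_mul (U W : T -> R) : independent_maps P U W ->
  U \in Lfun P 2%:E -> W \in Lfun P 2%:E -> 'E_P[U * W] = 'E_P[U] * 'E_P[W].
Proof.
move=> UW U2 W2.
have mU : measurable_fun setT U by move/sub_Lfun_mfun : U2; rewrite inE.
have mW : measurable_fun setT W by move/sub_Lfun_mfun : W2; rewrite inE.
have Pfin : P setT \is a fin_num := fin_num_measure P _ measurableT.
have iU : P.-integrable setT (EFin \o U).
  exact/Lfun1_integrable/(Lfun_subset12 Pfin).
have iW : P.-integrable setT (EFin \o W).
  exact/Lfun1_integrable/(Lfun_subset12 Pfin).
have iUW : P.-integrable setT (EFin \o (U * W)%R).
  exact/Lfun1_integrable/Lfun2_mul_Lfun1.
pose U' : {mfun T >-> R} := mfun_Sub (mem_set mU).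
pose W' : {mfun T >-> R} := mfun_Sub (mem_set mW).
rewrite unlock.
transitivity (\int[P]_w \int[P]_w' (U w * W w')%:E).
  have := @independent_fubini _ _ _ P _ _ _ _ U' W' UW (fun x => (x.1 * x.2)%:E).
  by apply => //; apply/measurable_EFinP; exact: measurable_funM.
under eq_integral do under eq_integral do rewrite EFinM.
under eq_integral do rewrite integralZl//.
have [/= r ->] : exists r, \int[P]_w (W w)%:E = r%:E.
  by have /fineK <- := integrable_fin_num measurableT iW; eexists.
by rewrite integralZr.
Qed.

End independent_product.

(** * Second moments of Levy processes *)

(** Cauchy's functional equation. The defect [g t = f t - f 1 * t] is additive and vanishes at 1,
    hence at [1 / k]. It is therefore periodic with a period at most [a], so it is bounded on the
    whole half-line, and [g (n * t) = n * g t] forces it to be 0. *)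
Lemma bounded_additive_linear {R : realType} (f : R -> R) (a M : R) :
  (forall s t : R, 0 <= s -> 0 <= t -> f (s + t) = f s + f t) ->
  0 < a -> (forall t : R, 0 <= t <= a -> `|f t| <= M) ->
  forall t : R, 0 <= t -> f t = f 1 * t.
Proof.
move=> fD a0 fM.
pose g t := f t - f 1 * t.
have gD s t : 0 <= s -> 0 <= t -> g (s + t) = g s + g t.
  by move=> s0 t0; rewrite /g fD// mulrDr; lra.
have g0 : g 0 = 0 by have := gD 0 0 (lexx 0) (lexx 0); rewrite addr0; lra.
have gn n t : 0 <= t -> g (n%:R * t) = n%:R * g t.
  move=> t0; elim: n => [|n ih]; first by rewrite !mul0r.
  by rewrite -natr1 !mulrDl !mul1r gD ?ih// mulr_ge0.
pose k := (Num.truncn a^-1).+1.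
have k0 : 0 < k%:R :> R by [].
have ka : k%:R^-1 <= a.
  by rewrite invf_ple ?posrE// ltW// truncnS_gt.
have gk : g k%:R^-1 = 0.
  have : g 1 = 0 by rewrite /g mulr1 subrr.
  have := @gn k k%:R^-1 (ltW _); rewrite mulfV ?gt_eqF// => ->; last first.
    by rewrite invr_gt0.
  by move=> /eqP; rewrite mulf_eq0 gt_eqF//= => /eqP.
pose M' := M + `|f 1| * a.
have gM t : 0 <= t -> `|g t| <= M'.
  move=> t0; pose j := Num.truncn (t * k%:R).
  have /andP[jt tj] : j%:R <= t * k%:R < j.+1%:R.
    by apply: truncn_itv; rewrite mulr_ge0// ltW.
  have r0 : 0 <= t - j%:R * k%:R^-1 by rewrite subr_ge0 ler_pdivrMr.
  have ra : t - j%:R * k%:R^-1 <= a.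
    apply: le_trans ka.
    by rewrite lerBlDr -[X in X + _]mul1r -mulrDl nat1r ler_pdivlMr// ltW.
  (* Subtracting [j] periods moves [t] into [[0, a]], where [f] is bounded. *)
  have -> : g t = g (t - j%:R * k%:R^-1).
    rewrite -[in LHS](subrK (j%:R * k%:R^-1) t) [LHS]gD//.
    by rewrite gn ?invr_ge0 ?ltW// gk mulr0 addr0.
  rewrite (le_trans (ler_normB _ _))// lerD ?fM ?r0//.
  by rewrite normrM ler_wpM2l// ger0_norm.
move=> t t0; apply/eqP; rewrite -subr_eq0 -/(g t); apply/negPn/negP => gt0.
have := gM ((Num.truncn (M' / `|g t|)).+1%:R * t) (mulr_ge0 (ler0n _ _) t0).
by rewrite gn// normrM ger0_norm// leNgt -ltr_pdivrMr ?normr_gt0// truncnS_gt.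
Qed.

Section expectation_complements.
Context {d} {T : measurableType d} {R : realType} (P : probability T R).
Implicit Types U V : T -> R.

Lemma Lfun_measurable p U : U \in Lfun P p -> measurable_fun setT U.
Proof. by move/sub_Lfun_mfun; rewrite inE. Qed.

Lemma Lfun2_Lfun1 U : U \in Lfun P 2%:E -> U \in Lfun P 1.
Proof. exact/Lfun_subset12/fin_num_measure. Qed.

Lemma Lfun2B U V : U \in Lfun P 2%:E -> V \in Lfun P 2%:E ->
  U - V \in Lfun P 2%:E.
Proof.
move=> U2 V2.
have p1 : (1 <= 2%:E :> \bar R)%E by rewrite lee_fin ler1n.
have [_ /(_ (-1) V U V2 U2)] := Lfun_submod_closed P p1.
by rewrite scaleN1r addrC.
Qed.

Lemma ae_eq_expectation U V : measurable_fun setT U -> measurable_fun setT V ->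
  {ae P, forall w, U w = V w} -> ('E_P[U] = 'E_P[V])%E.
Proof.
move=> mU mV UV; rewrite unlock; apply: ae_eq_integral => //.
- exact/measurable_EFinP.
- exact/measurable_EFinP.
- by apply: filterS UV => w /= ->.
Qed.

Lemma eq_distribution_expectation U V (f : R -> R) :
  measurable_fun setT U -> measurable_fun setT V -> measurable_fun setT f ->
  (forall B, measurable B -> P (U @^-1` B) = P (V @^-1` B)) ->
  ('E_P[f \o U] = 'E_P[f \o V])%E.
Proof.
move=> mU mV mf UV; rewrite unlock.
pose U' : {mfun T >-> R} := mfun_Sub (mem_set mU).
pose V' : {mfun T >-> R} := mfun_Sub (mem_set mV).
have mf' : measurable_fun setT (EFin \o f) by exact/measurable_EFinP.
have /= <- := integral_distribution_measurable P U' mf'.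
have /= <- := integral_distribution_measurable P V' mf'.
by apply: eq_measure_integral => B mB _; exact: UV.
Qed.

End expectation_complements.

Section levy_moments.
Context {d} {T : measurableType d} {R : realType} (P : probability T R).
Variable X : R -> T -> R.
Hypotheses (X_levy : levy_process P X) (X_L2 : square_integrable P X).

Let mX t : 0 <= t -> measurable_fun setT (X t).
Proof. by case: X_levy => + _ _ _ _ _; apply. Qed.

Let incr s h : T -> R := X (s + h) - X s.

Let incr_L2 s h : 0 <= s -> 0 <= h -> incr s h \in Lfun P 2%:E.
Proof. by move=> s0 h0; rewrite Lfun2B// X_L2// addr_ge0. Qed.

(** A Levy process starts at 0 only almost surely, so [X h] and its increment from 0 are different
    functions that agree almost everywhere. *)
Let incr0 h : {ae P, forall w, incr 0 h w = X h w}.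
Proof.
apply: filterS (levy_start0 X_levy) => w Xw.
by rewrite /incr add0r -[LHS]/(X h w - X 0 w) Xw subr0.
Qed.

Let expectation_incr (f : R -> R) s h : 0 <= s -> 0 <= h ->
  measurable_fun setT f -> ('E_P[f \o incr s h] = 'E_P[f \o X h])%E.
Proof.
move=> s0 h0 mf.
have mi r : 0 <= r -> measurable_fun setT (incr r h).
  by move=> r0; exact: Lfun_measurable (incr_L2 r0 h0).
transitivity ('E_P[f \o incr 0 h])%E.
  apply: eq_distribution_expectation => //; [exact: mi|exact: mi|] => B mB.
  have := levy_stationary X_levy s0 h0 mB.
  by rewrite /incr add0r.
apply: ae_eq_expectation.
- exact: measurableT_comp mf (mi _ _).
- exact: measurableT_comp mf (mX _).
- by apply: filterS (incr0 h) => w /= ->.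
Qed.

Let incr_independent s h : 0 <= s -> 0 <= h ->
  independent_maps P (incr 0 s) (incr s h).
Proof.
move=> s0 h0 A B mA mB.
(* Only the times 0, [s], [s + h] matter; the sequences are prolonged by constants because
   independence of increments is stated for infinite sequences. *)
pose t i : R := match i with 0%N => 0 | 1%N => s | _ => s + h end.
pose C i : set R := match i with 0%N => A | _ => B end.
have := @levy_independent _ _ _ _ _ X_levy 2%N t C (lexx 0).
have t_homo i : t i <= t i.+1 by case: i => [|[|i]] //=; rewrite lerDl.
have mC i : measurable (C i) by case: i.
move=> /(_ t_homo mC) /=.
rewrite big_ord_recr big_ord_recr big_ord0 /= mul1e => PE.
rewrite /incr add0r -PE; congr (P _).
apply/seteqP; split => [w [Aw Bw] [|[|i]]//|w ABw].
by split; [exact: (ABw 0%N)|exact: (ABw 1%N)].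
Qed.

Let m t : R := fine 'E_P[X t].
Let q t : R := fine 'E_P[X t ^+ 2].

Let mE t : 0 <= t -> ('E_P[X t] = (m t)%:E)%E.
Proof. by move=> t0; rewrite fineK// expectation_fin_num// Lfun2_Lfun1// X_L2. Qed.

Let qE t : 0 <= t -> ('E_P[X t ^+ 2] = (q t)%:E)%E.
Proof.
by move=> t0; rewrite fineK// expectation_fin_num// expr2 Lfun2_mul_Lfun1// X_L2.
Qed.

(** Replacing [X s] by the increment from 0 makes the two factors independent. *)
Let expectation_mul_incr s h : 0 <= s -> 0 <= h ->
  ('E_P[X s * incr s h] = (m s * m h)%:E)%E.
Proof.
move=> s0 h0.
transitivity ('E_P[incr 0 s * incr s h])%E.
  apply: ae_eq_expectation.
  - apply: measurable_funM; first exact: mX.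
    exact: Lfun_measurable (incr_L2 s0 h0).
  - apply: measurable_funM; first exact: Lfun_measurable (incr_L2 _ s0).
    exact: Lfun_measurable (incr_L2 s0 h0).
  - by apply: filterS (incr0 s) => w /= Xw; rewrite /= !fctE Xw.
rewrite independent_expectation_mul ?incr_L2//; last exact: incr_independent.
rewrite EFinM -!mE//.
by rewrite (@expectation_incr id)// (@expectation_incr id).
Qed.

Let mD s h : 0 <= s -> 0 <= h -> m (s + h) = m s + m h.
Proof.
move=> s0 h0; apply: EFin_inj; rewrite EFinD -!mE ?addr_ge0//.
rewrite -(@expectation_incr id s h)// -expectationD ?Lfun2_Lfun1 ?X_L2 ?incr_L2//.
by congr expectation; apply/funext => w; rewrite /incr !fctE /=; ring.
Qed.

Let expectation_mul s h : 0 <= s -> 0 <= h ->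
  ('E_P[X s * X (s + h)] = (q s + m s * m h)%:E)%E.
Proof.
move=> s0 h0; rewrite EFinD -qE// -expectation_mul_incr//.
rewrite -expectationD ?expr2 ?Lfun2_mul_Lfun1 ?X_L2 ?incr_L2//.
by congr expectation; apply/funext => w; rewrite /incr !fctE /=; ring.
Qed.

Let qD s h : 0 <= s -> 0 <= h -> q (s + h) = q s + 2 * m s * m h + q h.
Proof.
move=> s0 h0; apply: EFin_inj; rewrite -qE ?addr_ge0//.
have -> : (q s + 2 * m s * m h + q h = (q s + m s * m h) + m s * m h + q h)%R.
  by ring.
rewrite EFinD (EFinD (q s + m s * m h)%R) -expectation_mul//
  -expectation_mul_incr// -qE//.
rewrite -(@expectation_incr (fun x => x ^+ 2) s h)//.
have i2 : incr s h ^+ 2 \in Lfun P 1 by rewrite expr2 Lfun2_mul_Lfun1 ?incr_L2.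
rewrite -!expectationD ?rpredD ?expr2 ?Lfun2_mul_Lfun1 ?X_L2 ?incr_L2 ?addr_ge0//.
by congr expectation; apply/funext => w; rewrite /incr !fctE /=; ring.
Qed.

Let v t : R := q t - m t ^+ 2.

Let varianceX t : 0 <= t -> ('V_P[X t] = (v t)%:E)%E.
Proof. by move=> t0; rewrite varianceE ?X_L2// qE// mE. Qed.

Let variance_incr0 h : 0 <= h -> ('V_P[incr 0 h] = (v h)%:E)%E.
Proof.
move=> h0; rewrite varianceE ?incr_L2//.
rewrite (@expectation_incr (fun x => x ^+ 2) 0 h)// (@expectation_incr id 0 h)//.
by rewrite qE// mE.
Qed.

Let vD s h : 0 <= s -> 0 <= h -> v (s + h) = v s + v h.
Proof. by move=> s0 h0; rewrite /v mD// qD//; ring. Qed.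

Let v_ge0 t : 0 <= t -> 0 <= v t.
Proof. by move=> t0; rewrite -lee_fin -varianceX// variance_ge0. Qed.

(** Being additive and nonnegative, [v] is nondecreasing, hence bounded by [v 1] on [[0, 1]]. The
    mean has no sign, so its boundedness needs a separate argument. *)
Let v_linear t : 0 <= t -> v t = v 1 * t.
Proof.
apply: (@bounded_additive_linear _ v 1 (v 1)) => // h /andP[h0 h1].
have h10 : 0 <= 1 - h by rewrite subr_ge0.
by rewrite ger0_norm ?v_ge0// -[in leRHS](subrK h 1) vD// lerDr v_ge0.
Qed.

(* By continuity in probability and Chebyshev, for small [t] both [X t] and
   [X t - m t] are less than 1 in absolute value at some common point. *)
Let m_bounded : exists2 a, 0 < a & forall t, 0 <= t <= a -> `|m t| <= 2.
Proof.
have := levy_continuous X_levy (lexx 0) (@ltr01 R).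
have P2 : (0 < 2^-1%:E :> \bar R)%E by rewrite lte_fin invr_gt0.
move=> /(_ _ (open_ereal_lt' P2)) /nbhs_ballP[e /= e0 He].
(* Chosen so that [t <= c] gives [v t = v 1 * t < 1 / 2]; adding 1 covers the case [v 1 = 0]. *)
pose c := (2 * (v 1 + 1))^-1.
have v10 : 0 <= v 1 by rewrite v_ge0.
have c0 : 0 < c by rewrite invr_gt0; lra.
exists (Num.min (e / 2) c) => [|t]; first by rewrite lt_min c0 divr_gt0.
rewrite le_min => /and3P[t0 te tc].
have te' : t < e by lra.
have {}He : (P [set w | (1 <= `|X t w - X 0 w|)%R] < 2^-1%:E)%E.
  apply: He => //=; rewrite /ball/= sub0r normrN ger0_norm//.
have vt : v t < 2^-1.
  rewrite v_linear// (le_lt_trans (ler_wpM2l v10 tc))// /c invfM mulrCA.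
  by rewrite gtr_pMr// ltr_pdivrMr; lra.
rewrite leNgt; apply/negP => mt.
have mi := Lfun_measurable (incr_L2 (lexx 0) t0).
have mge (b : R) : measurable [set w | 1 <= `|incr 0 t w - b|].
  rewrite -[X in measurable X]setTI.
  apply: (measurable_fun_ler (measurable_cst (1 : R)) _ measurableT
    (Y := [set true])) => //.
  by apply: measurableT_comp => //; exact: measurable_funB.
pose I : {mfun T >-> R} := mfun_Sub (mem_set mi).
have Hm : (P [set w | (1 <= `|incr 0 t w - m t|)%R] <= (v t)%:E)%E.
  rewrite -variance_incr0// (_ : m t = fine 'E_P[incr 0 t]); last first.
    by rewrite (@expectation_incr id 0 t).
  by have := @chebyshev _ _ _ P I 1 ltr01; rewrite expr1n invr1 mul1e.
have : (P setT <= P [set w | (1 <= `|incr 0 t w - 0|)%R] +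
        P [set w | (1 <= `|incr 0 t w - m t|)%R])%E.
  rewrite (le_trans _ (measureU2 _ (mge 0) (mge (m t))))// le_measure ?inE//.
    exact: measurableU.
  move=> w _ /=; apply/orP; rewrite -implyNb -ltNge; apply/implyP.
  rewrite subr0 => iw; rewrite leNgt; apply/negP => iw'.
  have := ler_normB (incr 0 t w) (incr 0 t w - m t).
  by rewrite opprB addrC subrK; lra.
rewrite probability_setT leNgt => /negP; apply.
rewrite (_ : 1%E = 2^-1%:E + 2^-1%:E)%E; last first.
  by rewrite -EFinD [in LHS](splitr 1) mul1r.
apply: lteD.
  rewrite (_ : [set _ | _] = [set w | 1 <= `|X t w - X 0 w|])//.
  by apply/seteqP; split => w /=; rewrite subr0 /incr add0r.
by rewrite (le_lt_trans Hm)// lte_fin.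
Qed.

Let m_linear t : 0 <= t -> m t = m 1 * t.
Proof. by have [a a0 ma] := m_bounded; exact: bounded_additive_linear ma t. Qed.

Lemma levy_moments : exists m v : R, [/\ 0 <= v,
  forall t, 0 <= t -> ('E_P[X t] = (m * t)%:E)%E &
  forall s t, 0 <= s -> 0 <= t ->
    ('E_P[X s * X t] = (v * Num.min s t + m ^+ 2 * (s * t))%:E)%E].
Proof.
exists (m 1), (v 1); split => [|t t0|]; first exact: v_ge0.
  by rewrite mE// m_linear.
(* Writing [X t] as [X s] plus the increment over [[s, t]] gives [q s + m s * m (t - s)]; the case
   [t <= s] follows by symmetry. *)
have H s t : 0 <= s -> s <= t ->
    ('E_P[X s * X t] = (v 1 * s + m 1 ^+ 2 * (s * t))%:E)%E.
  move=> s0 st; have h0 : 0 <= t - s by rewrite subr_ge0.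
  rewrite -[t in LHS](subrK s) [_ + s]addrC expectation_mul//.
  rewrite -v_linear// /v (m_linear s0) (m_linear h0).
  by congr (_%:E); ring.
move=> s t s0 t0; have [st|/ltW ts] := leP s t; first exact: H.
by rewrite mulrC H// [s * t]mulrC.
Qed.

End levy_moments.

(** * Subordination *)

(** Joint measurability in time and path is what allows a random time to be inserted and Fubini's
    theorem to be applied. Time is cut off at 0 because nothing is assumed at negative times. *)
Lemma right_continuous_measurable {d} {T : measurableType d} {R : realType}
    (X : R -> T -> R) :
  (forall t, 0 <= t -> measurable_fun setT (X t)) ->
  (forall w t, 0 <= t -> X u w @[u --> t^'+] --> X t w) ->
  measurable_fun setT (fun z : R * T => X (Num.max 0 z.1) z.2).
Proof.
move=> mX cX.
(* [a n x] tends to [Num.max 0 x] strictly from the right and takes countably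
   many values. *)
pose k n (x : R) := Num.truncn (Num.max 0 x * n.+1%:R).
pose a n (x : R) := (k n x).+1%:R / n.+1%:R : R.
have n0 n : 0 < n.+1%:R :> R by [].
have kx n x : (k n x)%:R <= Num.max 0 x * n.+1%:R < (k n x).+1%:R.
  by apply: truncn_itv; rewrite mulr_ge0// le_max lexx.
apply: (measurable_fun_cvg (h := fun n z => X (a n z.1) z.2)) => [n|[x w] _ /=].
  (* On each of these countably many pieces the approximating time is constant, so only the
     measurability of [X] at one fixed time is used. *)
  pose D i := [set z : R * T | k n z.1 = i].
  have mD i : measurable (D i).
    have -> : D i = [set z : R * T | i%:R <= Num.max 0 z.1 * n.+1%:R] `&`
                    [set z : R * T | Num.max 0 z.1 * n.+1%:R < i.+1%:R].
      apply/seteqP; split => [z <-|z [/= iz zi]]; first exact/andP/kx.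
      by apply: truncn_def; rewrite iz.
    have mz : measurable_fun setT (fun z : R * T => Num.max 0 z.1 * n.+1%:R).
      by apply: measurable_funM => //; exact: measurable_maxr.
    apply: measurableI; rewrite -[X in measurable X]setTI.
      exact: (measurable_fun_ler _ mz measurableT (Y := [set true])).
    exact: (measurable_fun_ltr mz _ measurableT (Y := [set true])).
  have -> : [set: R * T] = \bigcup_i D i.
    by apply/seteqP; split => // z _; exists (k n z.1).
  apply/measurable_fun_bigcup => // i.
  apply: (eq_measurable_fun (X (i.+1%:R / n.+1%:R) \o snd)).
    by move=> z; rewrite inE /a => -[->].
  apply: measurable_funTS; apply: measurableT_comp => //.
  by apply: mX; rewrite divr_ge0.
have x0 : 0 <= Num.max 0 x by rewrite le_max lexx.
have /cvg_at_rightP := cX w _ x0; apply; split => [n|].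
  by rewrite ltr_pdivlMr//; case/andP : (kx n x).
apply/cvgrPdist_le => e e0.
near=> n; rewrite distrC.
have an : 0 <= a n x - Num.max 0 x <= n.+1%:R^-1.
  have /andP[h1 h2] := kx n x.
  rewrite subr_ge0 ler_pdivlMr// ltW//= lerBlDl.
  by rewrite ler_pdivrMr// mulrDl mulVf// -natr1 lerD2r.
case/andP: an => an1 an2; rewrite ger0_norm// (le_trans an2)//.
near: n; have /cvgrPdist_le/(_ _ e0) := @cvg_harmonic R.
by apply: filterS => n /=; rewrite sub0r normrN ger0_norm// invr_ge0.
Unshelve. all: by end_near. Qed.

(** * Integration over the path of Y with the random times held fixed *)

Section time_change_moments.
Context {d} {T : measurableType d} {R : realType} (P : probability T R).
Variables Y S : R -> T -> R.
Hypotheses (mY : forall t, 0 <= t -> measurable_fun setT (Y t))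
  (cY : forall w t, 0 <= t -> Y u w @[u --> t^'+] --> Y t w)
  (mS : forall t, 0 <= t -> measurable_fun setT (S t))
  (S_ge0 : forall t w, 0 <= t -> 0 <= S t w)
  (YS : independent_processes P Y S).

Lemma measurable_time_change t : 0 <= t ->
  measurable_fun setT (time_change Y S t).
Proof.
move=> t0.
apply: (eq_measurable_fun (fun w => Y (Num.max 0 (S t w)) w)).
  by move=> w _; rewrite (max_idPr _)// S_ge0.
have mU : measurable_fun setT (fun w => (S t w, w)).
  by apply: measurable_fun_pair => //; exact: mS.
exact: measurableT_comp (right_continuous_measurable mY cY) mU.
Qed.

Let gen (X : R -> T -> R) : set (set T) :=
  [set A | exists t B, [/\ 0 <= t, measurable B & A = X t @^-1` B]].

Let measurable_gen X t : 0 <= t ->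
  measurable_fun [set: g_sigma_algebraType (gen X)] (X t).
Proof.
move=> t0 _ B mB; rewrite setTI; apply: sub_sigma_algebra.
by exists t, B.
Qed.

(** The sigma-algebra generated by the process is contained in that of [T], so the identity is
    measurable towards the coarser space. *)
Let gen_measurable X : (forall t, 0 <= t -> measurable_fun setT (X t)) ->
  measurable_fun setT (id : T -> g_sigma_algebraType (gen X)).
Proof.
move=> mX _ B mB; rewrite setTI preimage_id; move: B mB.
apply: smallest_sub; first exact: sigma_algebra_measurable.
by move=> _ [t [B [t0 mB ->]]]; rewrite -[X in measurable X]setTI; exact: mX.
Qed.

(* The path of [Y] is encoded as the identity from [T] to [T] equipped with the
   sigma-algebra generated by [Y], so that [Y t w] is jointly measurable in
   [t] and the path. *)
Let W : {mfun T >-> g_sigma_algebraType (gen Y)} :=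
  mfun_Sub (mem_set (gen_measurable mY)).

Section two_times.
Variables s t : R.
Hypotheses (s0 : 0 <= s) (t0 : 0 <= t).

Let mU : measurable_fun setT (fun w => (S s w, S t w)).
Proof. by apply: measurable_fun_pair; exact: mS. Qed.

Let U : {mfun T >-> (R * R)%type} := mfun_Sub (mem_set mU).

(** Preimages under [W] are the events of [sigma_process Y] themselves, and those under [U] belong
    to [sigma_process S]. *)
Let UW : independent_maps P U W.
Proof.
move=> A B mA mB; rewrite setIC muleC; apply: YS; first exact: mB.
have mU' : measurable_fun [set: g_sigma_algebraType (gen S)]
    (fun w => (S s w, S t w)).
  by apply: measurable_fun_pair; exact: measurable_gen.
by have := mU' measurableT A mA; rewrite setTI.
Qed.

Variables (g : R * R -> R) (mg : measurable_fun setT g).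

Let F (z : (R * R) * g_sigma_algebraType (gen Y)) : \bar R :=
  (g (Y (Num.max 0 z.1.1) z.2, Y (Num.max 0 z.1.2) z.2))%:E.

Let mF : measurable_fun setT F.
Proof.
have mYg := right_continuous_measurable (fun t => @measurable_gen Y t) cY.
have m1 : measurable_fun setT
    (fun z : (R * R) * g_sigma_algebraType (gen Y) => (z.1.1, z.2)).
  by apply: measurable_fun_pair => //; exact: measurableT_comp.
have m2 : measurable_fun setT
    (fun z : (R * R) * g_sigma_algebraType (gen Y) => (z.1.2, z.2)).
  by apply: measurable_fun_pair => //; exact: measurableT_comp.
apply/measurable_EFinP; apply: (measurableT_comp mg).
by apply: measurable_fun_pair;
  [exact: measurableT_comp mYg m1|exact: measurableT_comp mYg m2].
Qed.

Let FE w w' : F (U w, W w') = (g (Y (S s w) w', Y (S t w) w'))%:E.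
Proof. by rewrite /F /= !(max_idPr _)// S_ge0. Qed.

Let QE w : (g (time_change Y S s w, time_change Y S t w))%:E = F (U w, W w).
Proof. by rewrite FE. Qed.

(** Independence lets the path of [Y] be drawn anew while the times [S s w] and [S t w] stay fixed.
    This nonnegative version yields the square integrability on which the signed version relies. *)
Lemma time_change_tonelli : (forall z, 0 <= g z) ->
  (\int[P]_w (g (time_change Y S s w, time_change Y S t w))%:E =
   \int[P]_w \int[P]_w' (g (Y (S s w) w', Y (S t w) w'))%:E)%E.
Proof.
move=> g0; under eq_integral do rewrite QE.
rewrite (independent_tonelli UW mF) => [|z]; last by rewrite lee_fin.
by apply: eq_integral => w _; apply: eq_integral => w' _; rewrite FE.
Qed.

Lemma time_change_fubini :
  P.-integrable setT
    (fun w => (g (time_change Y S s w, time_change Y S t w))%:E) ->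
  (\int[P]_w (g (time_change Y S s w, time_change Y S t w))%:E =
   \int[P]_w \int[P]_w' (g (Y (S s w) w', Y (S t w) w'))%:E)%E.
Proof.
move=> iQ; under eq_integral do rewrite QE.
rewrite (independent_fubini UW mF); last first.
  by apply: eq_integrable iQ => // w _; rewrite -QE.
by apply: eq_integral => w _; apply: eq_integral => w' _; rewrite FE.
Qed.

End two_times.

End time_change_moments.

Section second_moments.
Context {d} {T : measurableType d} {R : realType} (P : probability T R).
Implicit Types U : T -> R.

Lemma Lfun2_sqr U : measurable_fun setT U -> ('E_P[U ^+ 2] < +oo)%E ->
  U \in Lfun P 2%:E.
Proof.
move=> mU; rewrite expr2 unlock => U2.
rewrite inE; apply/andP; split; rewrite inE//= /finite_norm unlock.
rewrite poweR_lty// (le_lt_trans _ U2)// ge0_le_integral//.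
- by move=> w _; exact: poweR_ge0.
- apply/measurable_EFinP.
  apply/(@measurableT_comp _ _ _ _ _ _ (fun x : R => x `^ 2)%R) => //.
  exact/measurableT_comp.
- by apply/measurable_EFinP; exact: measurable_funM.
- move=> w _; rewrite lee_fin powR_mulrn// -normrX expr2 ger0_norm//.
  by rewrite -expr2 sqr_ge0.
Qed.

Lemma expectation_eq0_ae U : measurable_fun setT U -> (forall w, 0 <= U w) ->
  ('E_P[U] = 0)%E -> {ae P, forall w, U w = 0}.
Proof.
move=> mU U0; rewrite unlock => U1.
have mU' : measurable_fun setT (EFin \o U) by exact/measurable_EFinP.
have /(ae_eq_integral_abs P measurableT mU') : (\int[P]_w `|(U w)%:E| = 0)%E.
  by rewrite -[RHS]U1; apply: eq_integral => w _; rewrite gee0_abs// lee_fin.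
by apply: filterS => w /= /(_ I) [].
Qed.

End second_moments.

(** * Covariance and correlation of the subordinated process *)

Section time_change_correlation.
Context {d} {T : measurableType d} {R : realType} (P : probability T R).
Variables Y S : R -> T -> R.
Hypotheses (Y_levy : levy_process P Y) (Y_L2 : square_integrable P Y).
Hypotheses (S_sub : subordinator P S) (S_L2 : square_integrable P S).
Hypothesis YS : independent_processes P Y S.
Variables m v mu sg : R.
Hypotheses
  (Y_mean : forall t, 0 <= t -> ('E_P[Y t] = (m * t)%:E)%E)
  (Y_mul : forall s t, 0 <= s -> 0 <= t ->
    ('E_P[Y s * Y t] = (v * Num.min s t + m ^+ 2 * (s * t))%:E)%E)
  (S_mean : forall t, 0 <= t -> ('E_P[S t] = (mu * t)%:E)%E)
  (S_mul : forall s t, 0 <= s -> 0 <= t ->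
    ('E_P[S s * S t] = (sg * Num.min s t + mu ^+ 2 * (s * t))%:E)%E).

Let Q := time_change Y S.
(** The variance of [Q 1], by the law of total variance: [v * mu] is the mean of the conditional
    variance given [S], and [m ^+ 2 * sg] is the variance of the conditional mean. *)
Let K := v * mu + m ^+ 2 * sg.

Let mY t : 0 <= t -> measurable_fun setT (Y t).
Proof. by move=> t0; exact: Lfun_measurable (Y_L2 t0). Qed.

Let mS t : 0 <= t -> measurable_fun setT (S t).
Proof. by move=> t0; exact: Lfun_measurable (S_L2 t0). Qed.

Let cY w t : 0 <= t -> Y u w @[u --> t^'+] --> Y t w.
Proof. by case: Y_levy => _ _ _ _ _ /(_ w)[+ _]; apply. Qed.

Let S_ge0 t w : 0 <= t -> 0 <= S t w.
Proof. by case: S_sub => _ + _; apply. Qed.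

Let S_min s t w : 0 <= s -> 0 <= t ->
  Num.min (S s w) (S t w) = S (Num.min s t) w.
Proof.
move=> s0 t0; have Sle : forall s t, 0 <= s -> s <= t -> S s w <= S t w.
  by case: S_sub => _ _ + s1 t1; apply.
have [st|/ltW ts] := leP s t; first exact/min_idPl/Sle.
exact/min_idPr/Sle.
Qed.

Let mQ t : 0 <= t -> measurable_fun setT (Q t).
Proof. exact: measurable_time_change. Qed.

(** For fixed times the inner integral is given by [Y_mul]. Since [S] is nondecreasing, the minimum
    of its two values is its value at [Num.min s t], so the outer integral only involves known
    moments of [S]. *)
Let iterated s t : 0 <= s -> 0 <= t ->
  (\int[P]_w \int[P]_w' (Y (S s w) w' * Y (S t w) w')%:E =
   (K * Num.min s t + (m * mu) ^+ 2 * (s * t))%:E)%E.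
Proof.
move=> s0 t0; have st0 : 0 <= Num.min s t by rewrite le_min s0.
transitivity ('E_P[(v \o* S (Num.min s t) \+ m ^+ 2 \o* (S s * S t))%R])%E.
  rewrite unlock; apply: eq_integral => w _.
  have := Y_mul (S_ge0 w s0) (S_ge0 w t0); rewrite unlock => ->.
  by rewrite S_min//= mulrC [m ^+ 2 * _]mulrC.
have S1 := Lfun2_Lfun1 (S_L2 st0).
have SS := Lfun2_mul_Lfun1 (S_L2 s0) (S_L2 t0).
rewrite expectationD ?Lfun_scale// !expectationZl// S_mean// S_mul//.
by rewrite -!EFinM -EFinD; congr (_%:E); rewrite /K; ring.
Qed.

Lemma time_change_L2 : square_integrable P Q.
Proof.
move=> t t0; apply: Lfun2_sqr; first exact: mQ.
rewrite unlock.
have := @time_change_tonelli _ _ _ _ _ _ mY cY mS S_ge0 YS t t t0 t0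
  (fun z => z.1 ^+ 2) _ (fun z => sqr_ge0 _) => -> //.
  have := iterated t0 t0; rewrite -/(time_change _ _) => E.
  by under eq_integral do under eq_integral do rewrite expr2; rewrite E ltry.
by apply: measurable_funX.
Qed.

Let Q1 t (t0 : 0 <= t) : Q t \in Lfun P 1 := Lfun2_Lfun1 (time_change_L2 t0).

Let QQ1 s t (s0 : 0 <= s) (t0 : 0 <= t) : Q s * Q t \in Lfun P 1 :=
  Lfun2_mul_Lfun1 (time_change_L2 s0) (time_change_L2 t0).

Lemma time_change_mean t : 0 <= t -> ('E_P[Q t] = (m * mu * t)%:E)%E.
Proof.
move=> t0; transitivity ('E_P[m \o* S t])%E; last first.
  rewrite expectationZl ?S_mean ?Lfun2_Lfun1 ?S_L2// -EFinM.
  by congr (_%:E); ring.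
rewrite unlock.
rewrite (time_change_fubini mY cY mS S_ge0 YS t0 t0 measurable_fst); last first.
  exact/Lfun1_integrable/Q1.
apply: eq_integral => w _; have := Y_mean (S_ge0 w t0); rewrite unlock => -> /=.
by rewrite mulrC.
Qed.

Lemma time_change_covariance s t : 0 <= s -> 0 <= t ->
  (covariance P (Q s) (Q t) = (K * Num.min s t)%:E)%E.
Proof.
move=> s0 t0; rewrite covarianceE ?Q1 ?QQ1// !time_change_mean//.
rewrite [X in (X - _)%E](_ : _ = \int[P]_w ((Q s w * Q t w)%:E))%E; last first.
  by rewrite unlock.
have := @time_change_fubini _ _ _ _ _ _ mY cY mS S_ge0 YS s t s0 t0
  (fun z => z.1 * z.2) => -> //; last 2 first.
- by apply: measurable_funM.
- exact/Lfun1_integrable/QQ1.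
by rewrite iterated// -EFinM -EFinB; congr (_%:E); ring.
Qed.

Lemma time_change_long_range_dependent : 0 < K -> long_range_dependent P Q.
Proof.
move=> K0; split; first split.
- exact: time_change_L2.
- move=> t t0; rewrite /variance time_change_covariance ?ltW// minxx lte_fin.
  by rewrite mulr_gt0.
exists 2^-1; split; first by rewrite invr_gt0 ltr0n/= invf_lt1// ltr1n.
move=> s s0; exists (Num.sqrt s); first by rewrite sqrtr_gt0.
(* For [t >= s] the quotient equals [Num.sqrt s] exactly, so it is eventually constant. *)
apply: cvg_near_cst; near=> t.
have st : s <= t by near: t; apply: nbhs_pinfty_ge; rewrite num_real.
have t0 : 0 < t by exact: lt_le_trans st.
rewrite /corr /variance !time_change_covariance ?ltW// !minxx (min_idPl st) /=.
rewrite powRN powR12_sqrt ?ltW// invrK !sqrtrM ?ltW//.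
have K1 : Num.sqrt K != 0 by rewrite sqrtr_eq0 -ltNge.
have s1 : Num.sqrt s != 0 by rewrite sqrtr_eq0 -ltNge.
have t1 : Num.sqrt t != 0 by rewrite sqrtr_eq0 -ltNge.
(* With [K] and [s] written as squares of their roots, the identity is rational in the three
   roots. *)
rewrite -[X in X * s](sqr_sqrtr (ltW K0)) -[X in _ ^+ 2 * X](sqr_sqrtr (ltW s0)).
by field; rewrite K1 s1 t1.
Unshelve. all: by end_near. Qed.

End time_change_correlation.

(** * The TInG subordinator *)

Section gamma_density.
Context {R : realType} (alpha : R).
Hypotheses (alpha_gt0 : 0 < alpha) (alpha_le1 : alpha <= 1).

Definition gamma_density (y : R) : R := expR (- y) * y `^ (alpha - 1).

Local Notation mu := (@lebesgue_measure R).

Lemma gamma_density_ge0 y : 0 <= gamma_density y.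
Proof. by rewrite mulr_ge0 ?expR_ge0 ?powR_ge0. Qed.

(** Strictness comes from the exponential factor; the power is only nonincreasing, and constant when
    [alpha = 1]. *)
Lemma gamma_density_decreasing x y : 0 < x -> x < y ->
  gamma_density y < gamma_density x.
Proof.
move=> x0 xy; have y0 := lt_trans x0 xy.
rewrite /gamma_density (@lt_le_trans _ _ (expR (- x) * y `^ (alpha - 1)))//.
  by rewrite ltr_pM2r ?powR_gt0// ltr_expR ltrN2.
rewrite ler_pM2l ?expR_gt0// -(opprB 1 alpha) !powRN lef_pV2 ?posrE ?powR_gt0//.
by rewrite ge0_ler_powR ?subr_ge0 ?nnegrE// ltW.
Qed.

Lemma measurable_gamma_density : measurable_fun setT gamma_density.
Proof.
apply: measurable_funM => //.
by apply: (measurableT_comp (@measurable_expR R)); exact: oppr_measurable.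
Qed.

Let integral_powR a b : 0 < a -> a < b ->
  (\int[mu]_(y in `[a, b]) (y `^ (alpha - 1))%:E <= (b `^ alpha / alpha)%:E)%E.
Proof.
move=> a0 ab.
have dP (x : R) : 0 < x ->
    is_derive x 1 (fun y => alpha^-1 * y `^ alpha) (x `^ (alpha - 1)).
  move=> x0; have H := is_derive1_powR alpha x0.
  have := is_deriveZ alpha^-1 H.
  by rewrite /GRing.scale/= mulrA mulVf ?gt_eqF// mul1r.
have cP p (x : R) : 0 < x -> {for x, continuous (fun y : R => y `^ p)}.
  move=> x0; apply: differentiable_continuous; apply/derivable1_diffP.
  by have [] := is_derive1_powR p x0.
rewrite (@continuous_FTC2 _ _ (fun y => alpha^-1 * y `^ alpha))//.
- rewrite -EFinB lee_fin [alpha^-1 * b `^ _]mulrC lerBlDr lerDl.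
  by rewrite mulr_ge0 ?powR_ge0// invr_ge0 ltW.
- apply: continuous_in_subspaceT => x; rewrite inE/= in_itv/= => /andP[ax _].
  by apply: cP; exact: lt_le_trans ax.
- have c (x : R) : 0 < x -> {for x, continuous (fun y => alpha^-1 * y `^ alpha)}.
    by move=> x0; apply: cvgM; [exact: cvg_cst|exact: cP].
  split.
  + move=> x; rewrite in_itv/= => /andP[ax _].
    by have [] := dP x (lt_trans a0 ax).
  + by apply: cvg_at_right_filter; exact: c.
  + by apply: cvg_at_left_filter; apply: c; exact: lt_trans ab.
- move=> x; rewrite in_itv/= => /andP[ax _].
  by rewrite derive1E; have [_] := dP x (lt_trans a0 ax).
Qed.

(** The density is dominated by [y ^ (alpha - 1)], which may be singular at 0. Its integrals over
    compact intervals exhausting []0, b]] are bounded independently of the left endpoint, and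
    monotone convergence concludes. *)
Lemma integrable_gamma_density b : 0 < b ->
  mu.-integrable `]0, b[ (EFin \o gamma_density).
Proof.
move=> b0.
(* The shift by 2 keeps the left endpoint strictly below [b], as [integral_powR] requires. *)
pose F n := `[b / n.+2%:R, b]%classic.
have FE : \bigcup_n F n = `]0, b]%classic.
  apply/seteqP; split => [x [n _]|x]; rewrite /F/= !in_itv/=.
    by move=> /andP[bx ->]; rewrite (lt_le_trans _ bx)// divr_gt0.
  move=> /andP[x0 xb]; exists (Num.truncn (b / x)) => //.
  rewrite /= in_itv/= xb andbT ler_pdivrMr// -ler_pdivrMl// mulrC ltW//.
  by rewrite (lt_trans (truncnS_gt _))// ltr_nat.
pose h (y : R) := (y `^ (alpha - 1))%:E.
have mh D : measurable_fun D h.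
  by apply/measurable_EFinP; apply: measurable_funTS; exact: measurable_powR.
have h0 y : (0 <= h y)%E by rewrite lee_fin powR_ge0.
have hF : (\int[mu]_(y in `]0%R, b]) h y <= (b `^ alpha / alpha)%:E)%E.
  rewrite -FE; apply: (cvge_to_le (ge0_nondecreasing_set_cvg_integral _ _ _ _)).
  - move=> i j ij; rewrite subsetEset => x; rewrite /F/= !in_itv/=.
    move=> /andP[bx ->]; rewrite andbT (le_trans _ bx)// ler_pM2l//.
    by rewrite lef_pV2 ?posrE// ler_nat.
  - by move=> i; exact: measurable_itv.
  - by move=> i; exact: mh.
  - by [].
  - apply: nearW => n; apply: integral_powR; first by rewrite divr_gt0.
    by rewrite ltr_pdivrMr// ltr_pMr// ltr1n.
apply/integrableP; split.
  apply/measurable_EFinP; apply: measurable_funTS.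
  exact: measurable_gamma_density.
apply: (@le_lt_trans _ _ (\int[mu]_(y in `]0%R, b]) h y)%E); last first.
  by rewrite (le_lt_trans hF)// ltry.
apply: (@le_trans _ _ (\int[mu]_(y in `]0%R, b[) h y)%E).
  apply: ge0_le_integral => //.
  - apply: measurableT_comp => //; apply/measurable_EFinP; apply: measurable_funTS.
    exact: measurable_gamma_density.
  - exact: mh.
  - move=> y; rewrite /= in_itv/= => /andP[y0 _].
    rewrite lee_fin ger0_norm ?gamma_density_ge0// ler_piMl ?powR_ge0//.
    by rewrite -expR0 ler_expR oppr_le0 ltW.
apply: ge0_subset_integral => //; first exact: mh.
by move=> x; rewrite /= !in_itv/=; move=> /andP[-> /ltW].
Qed.

(** The difference is the integral of a decreasing density over [[a, b[], compared with its values
    at the endpoints. *)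
Lemma lower_gamma_bounds a b : 0 < a -> a < b ->
  (b - a) * gamma_density b <= lower_gamma alpha b - lower_gamma alpha a
    <= (b - a) * gamma_density a.
Proof.
move=> a0 ab; have b0 := lt_trans a0 ab.
have abE : `]0, a[%classic `|` `[a, b[%classic = `]0, b[%classic.
  apply/seteqP; split => x /=; rewrite !in_itv/=.
    by case=> /andP[h1 h2]; apply/andP; split => //; lra.
  by move=> /andP[x0 xb]; have [?|?] := ltP x a; [left|right]; apply/andP.
have ig := integrable_gamma_density b0.
have iab : mu.-integrable `[a, b[ (EFin \o gamma_density).
  apply: integrableS ig => //; rewrite -abE; exact: subsetUr.
rewrite /lower_gamma -/gamma_density -abE Rintegral_setU//; last 2 first.
- by rewrite abE.
- apply/disj_setPS => x [/=]; rewrite !in_itv/= => /andP[_ xa] /andP[ax _].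
  by rewrite ltNge ax in xa.
rewrite addrAC subrr add0r.
have muE : mu `[a, b[ = (b - a)%:E.
  by rewrite lebesgue_measure_itv/= lte_fin ab -EFinD.
have cE c : \int[mu]_(y in `[a, b[) c = (b - a) * c.
  by rewrite Rintegral_cst//= muE mulrC.
have ic c : mu.-integrable `[a, b[ (EFin \o (fun _ : R => c)).
  apply/integrableP; split; first exact: measurable_cst.
  by rewrite (integral_cst _ _ `|c|%:E)//= muE -EFinM ltry.
have gle x y : 0 < x -> x <= y -> gamma_density y <= gamma_density x.
  move=> x0; rewrite le_eqVlt => /predU1P[->//|xy].
  exact/ltW/gamma_density_decreasing.
rewrite -!cE; apply/andP.
by split; apply: le_Rintegral => // x; rewrite /= in_itv/= => /andP[ax xb];
  apply: gle => //; [exact: lt_le_trans ax|exact: ltW].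
Qed.

End gamma_density.

(** With [x = exp (- a)] and [y = exp (- b)], the left side is [(1 - x) ^ 2 + (y - x ^ 2)]. The
    first term is at most [a ^ 2], and the second, [y * (1 - exp (- (2 * a - b)))], is at most
    [2 * a - b]. *)
Lemma expR_second_difference {R : realType} (a b c e : R) :
  0 <= a -> a <= c -> 0 <= b -> b <= 2 * a -> 2 * a - b <= e ->
  1 - 2 * expR (- a) + expR (- b) <= c ^+ 2 + e.
Proof.
move=> a0 ac b0 ba be.
have ea : 1 - expR (- a) <= a by have := expR_ge1Dx (- a); lra.
have ea0 : 0 <= 1 - expR (- a) by rewrite subr_ge0 expR_le1 oppr_le0.
have ea2 : (1 - expR (- a)) ^+ 2 <= c ^+ 2.
  have h := le_trans ea ac.
  by rewrite ler_sqr ?nnegrE// (le_trans ea0).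
have eb : expR (- b) - expR (- a) ^+ 2 <= 2 * a - b.
  have -> : expR (- a) ^+ 2 = expR (- b) * expR (- (2 * a - b)).
    by rewrite -expRD expr2 -expRD; congr expR; ring.
  have h1 : 1 - expR (- (2 * a - b)) <= 2 * a - b.
    by have := expR_ge1Dx (- (2 * a - b)); lra.
  have h2 : expR (- b) <= 1 by rewrite expR_le1 oppr_le0.
  rewrite -[X in X - _]mulr1 -mulrBr (le_trans _ h1)// ler_piMl//.
  by rewrite subr_ge0 expR_le1 oppr_le0 subr_ge0.
have -> : 1 - 2 * expR (- a) + expR (- b) =
    (1 - expR (- a)) ^+ 2 + (expR (- b) - expR (- a) ^+ 2) by ring.
by rewrite lerD// (le_trans eb).
Qed.

(** * Square integrability and non-degeneracy of the TInG subordinator *)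

Section ting_moments.
Context {d} {T : measurableType d} {R : realType} (P : probability T R).
Variables (alpha theta : R) (S : R -> T -> R).
Hypotheses (alpha_gt0 : 0 < alpha) (alpha_le1 : alpha <= 1) (theta_gt0 : 0 < theta).
Hypothesis S_ting : ting_subordinator P alpha theta S.

Let g := gamma_density alpha.
Let phi eta :=
  alpha * lower_gamma alpha (eta + theta) - alpha * lower_gamma alpha theta.

Let S_sub : subordinator P S. Proof. by case: S_ting. Qed.

Let mS t : 0 <= t -> measurable_fun setT (S t).
Proof. by case: S_sub => -[+ _ _ _ _ _] _ _; apply. Qed.

Let S_ge0 t w : 0 <= t -> 0 <= S t w.
Proof. by case: S_sub => _ + _; apply. Qed.

Let laplace t eta : 0 <= t -> 0 < eta ->
  ('E_P[fun w => expR (- eta * S t w)%R] = (expR (- t * phi eta))%:E)%E.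
Proof. by case: S_ting => _; apply. Qed.

Let phi_bounds x y : 0 <= x -> x < y ->
  alpha * ((y - x) * g (theta + y)) <= phi y - phi x <=
  alpha * ((y - x) * g (theta + x)).
Proof.
move=> x0 xy.
have tx : 0 < theta + x by rewrite ltr_wpDr.
have txy : theta + x < theta + y by rewrite ltrD2l.
have := lower_gamma_bounds alpha_gt0 alpha_le1 tx txy.
rewrite (_ : theta + y - (theta + x) = y - x); last by ring.
have -> : phi y - phi x =
    alpha * (lower_gamma alpha (theta + y) - lower_gamma alpha (theta + x)).
  by rewrite /phi ![_ + theta]addrC; ring.
by rewrite !ler_pM2l.
Qed.

Let phi0 : phi 0 = 0. Proof. by rewrite /phi add0r subrr. Qed.

(** The ratio [g (y + h) / g y] is at least [(1 - h) * (y / (y + h))]: the exponential gives the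
    first factor, and monotonicity of [y ^ alpha] gives the second. *)
Let density_drop y h : 0 < y -> 0 <= h ->
  g y - g (y + h) <= h * (g y * (1 + y^-1)).
Proof.
move=> y0 h0; have yh : 0 < y + h by rewrite ltr_wpDr.
have h1 : y `^ (alpha - 1) * (y / (y + h)) <= (y + h) `^ (alpha - 1).
  have pE x : 0 < x -> x `^ (alpha - 1) * x = x `^ alpha.
    by move=> x0; rewrite mulrC mulr_powRB1// ltW.
  rewrite mulrA ler_pdivrMr// !pE//.
  by apply: ge0_ler_powR; rewrite ?nnegrE ?lerDl// ltW.
have h2 : 1 - h <= expR (- h) by have := expR_ge1Dx (- h).
have r0 : 0 <= y / (y + h) by rewrite divr_ge0// ltW.
have r1 : 1 - h * y^-1 - h <= (1 - h) * (y / (y + h)).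
  have e : y / (y + h) = 1 - h / (y + h) by field; rewrite gt_eqF.
  have h3 : h / (y + h) <= h * y^-1 by rewrite ler_wpM2l// lef_pV2// lerDl.
  have h4 : h * (y / (y + h)) <= h.
    by rewrite ler_piMr// ler_pdivrMr// mul1r lerDl.
  by rewrite mulrBl mul1r; lra.
have gyh : g y * ((1 - h) * (y / (y + h))) <= g (y + h).
  rewrite mulrCA; apply: (le_trans (ler_wpM2r _ h2)).
    by rewrite mulr_ge0// gamma_density_ge0.
  rewrite /g /gamma_density opprD expRD [expR (- y) * expR _]mulrC -!mulrA.
  by rewrite !ler_pM2l ?expR_gt0.
have := ler_wpM2l (gamma_density_ge0 alpha y) r1; rewrite -/(g y).
by move/le_trans => /(_ _ gyh); lra.
Qed.

(** The coefficients of [eta ^+ 2] in [c ^+ 2] and [e] when [expR_second_difference] is applied with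
    [c = t * alpha * g theta * eta]. *)
Let bound t :=
  (t * alpha * g theta) ^+ 2 + 2 * (t * alpha * g theta) * (1 + theta^-1).

Let laplace_second_difference t eta : 0 <= t -> 0 < eta ->
  1 - 2 * expR (- t * phi eta) + expR (- t * phi (2 * eta)) <= bound t * eta ^+ 2.
Proof.
move=> t0 eta0.
have e2 : eta < 2 * eta by lra.
have /andP[l1 u1] := phi_bounds (lexx 0) eta0.
have /andP[l2 u2] := phi_bounds (ltW eta0) e2.
rewrite phi0 !subr0 addr0 in l1 u1.
rewrite (_ : 2 * eta - eta = eta) in l2 u2; last by ring.
set a := t * phi eta; set b := t * phi (2 * eta).
have g0 y : 0 <= g y by exact: gamma_density_ge0.
have age0 y : 0 <= alpha * (eta * g y).
  by apply: mulr_ge0; [exact: ltW|apply: mulr_ge0 => //; exact: ltW].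
have a0 : 0 <= a by apply: mulr_ge0 => //; exact: le_trans l1.
have b0 : 0 <= b - a.
  by rewrite /b /a -mulrBr; apply: mulr_ge0 => //; exact: le_trans l2.
have au : a <= t * alpha * g theta * eta.
  rewrite (le_trans (ler_wpM2l t0 u1))// le_eqVlt.
  by apply/orP; left; apply/eqP; ring.
(* Concavity of [phi]: its increments over [[0, eta]] and [[eta, 2 * eta]] are separated by
   [alpha * (eta * g (theta + eta))]. *)
have ab : b <= 2 * a.
  have : phi (2 * eta) - phi eta <= phi eta by exact: le_trans u2 l1.
  by move=> /(ler_wpM2l t0); rewrite mulrBr -/a -/b; lra.
have tae : 0 <= t * (alpha * eta).
  by apply: mulr_ge0 => //; apply: mulr_ge0; exact: ltW.
have ab2 : 2 * a - b <= 2 * (t * alpha * g theta) * (1 + theta^-1) * eta ^+ 2.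
  have e20 : 0 <= 2 * eta by lra.
  have gd := density_drop theta_gt0 e20.
  have h : t * (phi eta - (phi (2 * eta) - phi eta)) <=
      t * (alpha * eta) * (g theta - g (theta + 2 * eta)).
    rewrite -mulrA ler_wpM2l// -mulrA mulrBr; rewrite !mulrBr; lra.
  rewrite (_ : 2 * a - b = t * (phi eta - (phi (2 * eta) - phi eta))).
    apply: (le_trans h); apply: (le_trans (ler_wpM2l tae gd)).
    by rewrite le_eqVlt; apply/orP; left; apply/eqP; ring.
  by rewrite /a /b; ring.
have -> : bound t * eta ^+ 2 = (t * alpha * g theta * eta) ^+ 2 +
    2 * (t * alpha * g theta) * (1 + theta^-1) * eta ^+ 2.
  by rewrite /bound; ring.
have b0' : 0 <= b by rewrite -(subrK a b) addr_ge0.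
by rewrite !mulNr; exact: (expR_second_difference a0 au b0' ab ab2).
Qed.

(* [min x 1 <= 2 (1 - exp (- x))] bounds the truncated second moments by the
   second difference of the Laplace transform at [eta = (n + 1)^-1]. *)
Let truncated_second_moment t n : 0 <= t ->
  (\int[P]_w (Num.min (S t w) n.+1%:R ^+ 2)%:E <= (4 * bound t)%:E)%E.
Proof.
move=> t0; pose eta : R := n.+1%:R^-1.
have eta0 : 0 < eta by rewrite invr_gt0.
have eta20 : 0 < 2 * eta by lra.
pose U w : R := expR (- eta * S t w).
have mU : measurable_fun setT U.
  by apply: measurableT_comp => //; apply: measurable_funM => //; exact: mS.
(* The square of [U] is the Laplace variable at [2 * eta], so the mean of [(1 - U) ^+ 2] is the
   second difference. *)
have U2 : ('E_P[U * U] = (expR (- t * phi (2 * eta)))%:E)%E.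
  rewrite -laplace//; congr expectation; apply/funext => w.
  by rewrite /U !fctE -expRD; congr expR; ring.
have UL2 : U \in Lfun P 2%:E by apply: Lfun2_sqr; rewrite ?expr2 ?U2 ?ltry.
have U1 := Lfun2_Lfun1 UL2.
have UU1 := Lfun2_mul_Lfun1 UL2 UL2.
have E : ('E_P[(fun w => 4 * n.+1%:R ^+ 2 * (1 - U w) ^+ 2)%R] =
    (4 * n.+1%:R ^+ 2 *
      (1 - 2 * expR (- t * phi eta) + expR (- t * phi (2 * eta))))%:E)%E.
  rewrite (_ : (fun _ => _) = (4 * n.+1%:R ^+ 2) \o*
      ((cst 1 \+ -2 \o* U) \+ U * U)); last first.
    by apply/funext => w; rewrite /= !fctE; ring.
  rewrite expectationZl; last by rewrite !rpredD ?Lfun_cst ?Lfun_scale.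
  rewrite expectationD ?rpredD ?Lfun_cst ?Lfun_scale//.
  rewrite expectationD ?Lfun_cst ?Lfun_scale// expectationZl//.
  rewrite expectation_cst U2 laplace// -!EFinM; congr (_%:E).
  by rewrite mulNr.
apply: (@le_trans _ _ (\int[P]_w (4 * n.+1%:R ^+ 2 * (1 - U w) ^+ 2)%:E)%E).
  apply: ge0_le_integral => //.
  - by move=> w _; rewrite lee_fin sqr_ge0.
  - apply/measurable_EFinP; apply: measurable_funX.
    by apply: measurable_minr => //; exact: mS.
  - apply/measurable_EFinP; apply: measurable_funM => //.
    by apply: measurable_funX; apply: measurable_funB.
  - move=> w _; rewrite lee_fin.
    have -> : 4 * n.+1%:R ^+ 2 * (1 - U w) ^+ 2 = (2 * n.+1%:R * (1 - U w)) ^+ 2.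
      by ring.
    pose x := eta * S t w.
    have x0 : 0 <= x by rewrite mulr_ge0 ?S_ge0// ltW.
    have SE : S t w = n.+1%:R * x by rewrite /x mulrA mulfV// mul1r.
    (* Here [1 - exp (- x) >= x / (1 + x)], which is at least [x / 2] for [x <= 1] and at least
       [1 / 2] beyond. *)
    have h : Num.min x 1 <= 2 * (1 - U w).
      rewrite /U mulNr -/x expRN.
      have ex := expR_ge1Dx x.
      have x1 : 0 < 1 + x by lra.
      have : (expR x)^-1 <= (1 + x)^-1 by rewrite lef_pV2 ?posrE ?expR_gt0.
      have e : (1 + x)^-1 = 1 - x / (1 + x) by field; rewrite gt_eqF.
      have [xle|xgt] := leP x 1.
        have : x / 2 <= x / (1 + x) by rewrite ler_wpM2l// lef_pV2 ?posrE//; lra.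
        by lra.
      have : 2^-1 <= x / (1 + x) by rewrite ler_pdivlMr//; lra.
      by lra.
    have m0 : 0 <= Num.min (S t w) n.+1%:R by rewrite le_min S_ge0//=.
    have hm : Num.min (S t w) n.+1%:R <= 2 * n.+1%:R * (1 - U w).
      rewrite SE -[X in Num.min _ X]mulr1 -minr_pMr//.
      by rewrite (le_trans (ler_wpM2l _ h))// mulrA [_ * 2]mulrC.
    by rewrite ler_sqr ?nnegrE// (le_trans m0).
have := E; rewrite unlock => ->; rewrite lee_fin -mulrA ler_pM2l//.
have := laplace_second_difference t0 eta0.
move=> /(ler_wpM2l (sqr_ge0 (n.+1%:R : R))) /le_trans; apply.
by rewrite mulrCA -exprMn mulfV// expr1n mulr1.
Qed.

(** The truncated second moments are bounded uniformly in [n], and monotone convergence removes the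
    truncation. *)
Lemma ting_square_integrable : square_integrable P S.
Proof.
move=> t t0; apply: Lfun2_sqr; first exact: mS.
rewrite expr2 unlock.
pose f n w := (Num.min (S t w) n.+1%:R ^+ 2)%:E.
have mf n : measurable_fun setT (f n).
  apply/measurable_EFinP; apply: measurable_funX.
  by apply: measurable_minr => //; exact: mS.
have f0 n w : setT w -> (0 <= f n w)%E by move=> _; rewrite lee_fin sqr_ge0.
have f_homo w : setT w -> nondecreasing_seq (f ^~ w).
  move=> _ i j ij; have St := S_ge0 w t0.
  rewrite lee_fin ler_sqr ?nnegrE ?le_min ?St ?ler0n//.
  by rewrite ge_min lexx/= ge_min ler_nat ltnS ij orbT.
have fS w : f n w @[n --> \oo] --> ((S t * S t) w)%:E.
  apply: cvg_near_cst; near=> n; rewrite /f (min_idPl _)//.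
  rewrite ltW// (lt_le_trans (truncnS_gt _))// ler_nat ltnS.
  by near: n; exact: nbhs_infty_ge.
apply: (@le_lt_trans _ _ (4 * bound t)%:E); last by rewrite ltry.
rewrite (_ : (\int[P]_w _)%E = (\int[P]_w limn (f ^~ w))%E).
  apply: (cvge_to_le (cvg_monotone_convergence measurableT mf f0 f_homo)).
  by apply: nearW => n; exact: truncated_second_moment.
by apply: eq_integral => w _; apply/esym/cvg_lim => //; exact: fS.
Unshelve. all: by end_near. Qed.

(** Otherwise [phi] would be linear, with equal increments over [[0, 1]] and [[2, 3]]. But the
    former is at least [alpha * g (theta + 1)] and the latter at most [alpha * g (theta + 2)], which
    is strictly smaller. *)
Lemma ting_not_constant c : ~ {ae P, forall w, S 1 w = c}.
Proof.
move=> Sc.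
have phiE eta : 0 < eta -> phi eta = eta * c.
  move=> eta0; have := laplace ler01 eta0.
  rewrite (@ae_eq_expectation _ _ _ _ _ (cst (expR (- eta * c)))); last 3 first.
  - by apply: measurableT_comp => //; apply: measurable_funM => //; exact: mS.
  - exact: measurable_cst.
  - by apply: filterS Sc => w ->.
  rewrite expectation_cst => -[]/expR_inj; lra.
have phi1 : phi 1 = c by rewrite phiE// mul1r.
have := phi_bounds (lexx 0) (@ltr01 R).
have h23 : (2 : R) < 3 by lra.
have := phi_bounds (ltW (@ltr0Sn R 1)) h23.
rewrite phi0 !phiE//.
have -> : 3 * c - 2 * c = c by ring.
have -> : (3 : R) - 2 = 1 by ring.
rewrite !subr0 !mul1r => /andP[_ h1] /andP[h2 _].
have := le_trans h2 h1; rewrite ler_pM2l// leNgt => /negP; apply.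
by apply: gamma_density_decreasing => //; rewrite ?ltrD2l ?ltr1n ?addr_gt0.
Qed.

End ting_moments.

(** * Positivity of the variance rate and long-range dependence *)

Theorem theorem5p4 (d : measure_display) (T : measurableType d) (R : realType)
    (P : probability T R) (alpha theta : R) (Y S : R -> T -> R)
    (alpha_gt0 : 0 < alpha) (alpha_le1 : alpha <= 1) (theta_gt0 : 0 < theta)
    (Y_levy : levy_process P Y)
    (Y_L2 : square_integrable P Y) (Y_neq0 : nonzero_process P Y)
    (S_ting : ting_subordinator P alpha theta S)
    (YS_indep : independent_processes P Y S) :
  long_range_dependent P (time_change Y S).
Proof.
have [S_sub _] := S_ting; have S_levy := subordinator_levy S_sub.
have S_L2 := ting_square_integrable alpha_gt0 alpha_le1 theta_gt0 S_ting.
have S_not_cst := ting_not_constant alpha_gt0 alpha_le1 theta_gt0 S_ting.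
have [m [v [v0 Y_mean Y_mul]]] := levy_moments Y_levy Y_L2.
have [mu [sg [sg0 S_mean S_mul]]] := levy_moments S_levy S_L2.
have mS1 := Lfun_measurable (S_L2 1 ler01).
have S1_ge0 w : 0 <= S 1 w by case: S_sub => _ + _; apply.
have mu_gt0 : 0 < mu.
  rewrite lt_neqAle -lee_fin -[mu]mulr1 -S_mean// expectation_ge0// andbT.
  apply/eqP => mu0; apply: (S_not_cst 0).
  by apply: expectation_eq0_ae => //; rewrite S_mean// -mu0.
have sg_gt0 : 0 < sg.
  rewrite lt_neqAle sg0 andbT; apply/eqP => sg_eq0; apply: (S_not_cst mu).
  (* The mean of [Z] is the variance [sg] of [S 1]. *)
  pose Z w := (S 1 w - mu) ^+ 2.
  have mZ : measurable_fun setT Z.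
    by apply: measurable_funX; apply: measurable_funB.
  have : ('E_P[Z] = 0)%E.
    have -> : Z = S 1 * S 1 \+ (-2 * mu \o* S 1 \+ cst (mu ^+ 2)).
      by apply/funext => w; rewrite /Z /= !fctE; ring.
    have S11 := Lfun2_Lfun1 (S_L2 1 ler01).
    have SS1 := Lfun2_mul_Lfun1 (S_L2 1 ler01) (S_L2 1 ler01).
    rewrite expectationD ?rpredD ?Lfun_scale ?Lfun_cst//.
    rewrite expectationD ?Lfun_scale ?Lfun_cst// expectationZl//.
    rewrite expectation_cst S_mul// S_mean// -sg_eq0 -!EFinM -!EFinD.
    by congr (_%:E); ring.
  move/expectation_eq0_ae => /(_ mZ (fun w => sqr_ge0 _)).
  by apply: filterS => w /eqP; rewrite sqrf_eq0 subr_eq0 => /eqP.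
apply: (@time_change_long_range_dependent _ _ _ _ _ _ Y_levy Y_L2 S_sub S_L2
  YS_indep m v mu sg) => //.
have vmu0 : 0 <= v * mu by rewrite mulr_ge0// ltW.
have msg0 : 0 <= m ^+ 2 * sg by rewrite mulr_ge0 ?sqr_ge0// ltW.
(* If [K] vanished, so would [v] and [m], and [Y] would be null. A pure drift, with [v = 0] and [m]
   nonzero, is allowed: the randomness of [S] then makes [K] positive. *)
rewrite lt_neqAle addr_ge0// andbT eq_sym; apply/negP.
rewrite paddr_eq0//.
rewrite !mulf_eq0 orbb (gt_eqF mu_gt0) (gt_eqF sg_gt0) !orbF.
move=> /andP[/eqP v_eq0 /eqP m_eq0].
have [t t0] := Y_neq0; apply.
have mYt := Lfun_measurable (Y_L2 t t0).
have /expectation_eq0_ae H : ('E_P[Y t * Y t] = 0)%E.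
  by rewrite Y_mul// v_eq0 m_eq0 !(mul0r, expr0n) addr0.
have := H (measurable_funM mYt mYt) (fun w => sqr_ge0 (Y t w)).
by apply: filterS => w /eqP; rewrite mulf_eq0 orbb => /eqP.
Qed.
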